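(* Let $\mathcal{H}$ be a complex Hilbert space, let $S\in\mathcal{L}(\mathcal{H})$ and let $T\in\mathcal{L}(\mathcal{H})$ be a Hermitian operator with closed range such that $S=TG$ for some invertible $G\in\mathcal{L}(\mathcal{H})$. Then the projection proper splitting $T=P_T-V$ of $T$ induces a proper splitting of $S$, namely $S=P_TG-VG$. Moreover, the projection proper splitting of $T$ converges if and only if the proper splitting $S=P_TG-VG$ converges.
   Context: $P_T$ is the orthogonal projection onto $\mathcal{R}(T)$. A proper splitting of a closed range operator $A$ is a decomposition $A=U-V$ with $U,V\in\mathcal{L}(\mathcal{H})$, $\mathcal{R}(U)=\mathcal{R}(A)$ and $\mathcal{N}(U)=\mathcal{N}(A)$; it converges if $\rho(U^\dagger V)<1$, where $\rho$ is the spectral radius and $U^\dagger$ the Moore-Penrose inverse. The projection proper splitting of a closed range Hermitian $T$ is $T=P_T-V$, i.e. $V=P_T-T$. *)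

(* Defs.v *)
From HB Require Import structures.
From mathcomp Require Import all_boot all_order all_algebra complex.
From mathcomp Require Import all_classical all_reals all_analysis.

Set Implicit Arguments.
Unset Strict Implicit.
Unset Printing Implicit Defensive.
Import Order.TTheory GRing.Theory Num.Theory.
Import numFieldNormedType.Exports.

Local Open Scope classical_set_scope.
Local Open Scope complex_scope.
Local Open Scope ring_scope.

(* Complex Hilbert spaces. The form is linear in its first argument and
   conjugate-linear in the second. *)
HB.mixin Record isHilbert (R : realType) H of CompleteNormedModule R[i] H := {
  inner : {dot H for (@Num.conj R[i])} ;
  sqr_norm_inner : forall x : H, `|x| ^+ 2 = inner x x
}.

#[short(type="hilbertType")]
HB.structure Definition Hilbert (R : realType) :=
  {H of isHilbert R H & CompleteNormedModule R[i] H}.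

Notation "''[' x , y ]" := (inner x y) : ring_scope.

Section HilbertOperators.
Context {R : realType} {H : hilbertType R}.
Implicit Types (A B U V X : H -> H) (M : set H) (z : R[i]).

(* The elements of L(H): over normed modules, a linear map is continuous iff
   it is bounded (linear_bounded_continuous). *)
Definition bounded_operator A := linear A /\ continuous A.

Definition invertible_operator A :=
  bounded_operator A /\
  exists2 B, bounded_operator B & A \o B = id /\ B \o A = id.

Definition closed_range A := closed (range A).

Definition kernel A : set H := [set x | A x = 0].

Definition is_adjoint A B := forall x y, '[A x, y] = '[x, B y].

Definition hermitian_operator A := is_adjoint A A.

(* For a closed subspace M, [orth_proj M x] is the unique point y of M such
   that x - y is orthogonal to M; elsewhere xget may fall back on 0. *)
Definition orth_proj M : H -> H := fun x =>
  xget 0 [set y | M y /\ forall m, M m -> '[x - y, m] = 0].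

(* P_A in the usual notation *)
Definition range_proj A : H -> H := orth_proj (range A).

Definition is_moore_penrose A X :=
  [/\ bounded_operator X,
      A \o X \o A = A, X \o A \o X = X,
      hermitian_operator (A \o X) & hermitian_operator (X \o A)].

(* The unique solution of the Penrose equations, which exists when A is a
   bounded operator with closed range; the default value 0 is used otherwise. *)
Definition moore_penrose A : H -> H :=
  xget (fun=> 0) [set X | is_moore_penrose A X].

Definition spectrum A : set R[i] :=
  [set z | ~ invertible_operator (fun x => A x - z *: x)].

(* The spectrum of a bounded operator is bounded, so this supremum is a
   genuine one; on the zero space, where the spectrum is empty, it is 0. *)
Definition spectral_radius A : R :=
  sup [set complex.Re `|z| | z in spectrum A].

Definition proper_splitting A U V :=
  [/\ bounded_operator A /\ closed_range A,
      bounded_operator U /\ bounded_operator V,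
      A = U \- V, range U = range A & kernel U = kernel A].

Definition splitting_converges U V :=
  spectral_radius (moore_penrose U \o V) < 1.

End HilbertOperators.

(* Main.v *)
(* Put U = P_T G and X = U^dagger. Since T is Hermitian with closed range, P_T
   and T have the same range and kernel, which gives the proper splitting and
   V P_T = V. Moreover U X = P_T, because U and P_T have the same range. The
   operators X (V G) and (V G) X have the same nonzero spectrum, and
   (V G) X = V P_T G X = V P_T = V; so the iteration operator X V G of the
   splitting of S has the spectral radius of V, whatever the invertible G. The
   splitting of T itself is the case G = 1. *)
Require Import Defs.
From mathcomp Require Import all_boot all_order all_algebra complex.
From mathcomp Require Import all_classical all_reals all_analysis.
From mathcomp Require Import ring lra.

Import Order.TTheory GRing.Theory Num.Theory.
Import numFieldNormedType.Exports.

Local Open Scope classical_set_scope.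
Local Open Scope complex_scope.
Local Open Scope ring_scope.

(** * Nearest points and orthogonal projections in a Hilbert space *)

Section OrthogonalProjection.
Context {R : realType} {H : hilbertType R}.
Implicit Types (x y z u v m : H) (M : set H) (A B : H -> H).

(* The norm of [H] takes its values in [R[i]]; infima are taken in [R]. *)
Definition real_norm x : R := complex.Re `|x|.

Lemma real_normE x : `|x| = (real_norm x)%:C.
Proof. by rewrite RRe_real// normr_real. Qed.

Lemma inner_real_norm x : '[x, x] = (real_norm x ^+ 2)%:C.
Proof. by rewrite -sqr_norm_inner real_normE rmorphXn. Qed.

Lemma real_norm_ge0 x : 0 <= real_norm x.
Proof. by rewrite -ler0c -real_normE. Qed.

Lemma ler_real_normD x y : real_norm (x + y) <= real_norm x + real_norm y.
Proof. by rewrite -lecR rmorphD/= -!real_normE ler_normD. Qed.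

Lemma parallelogram x y :
  real_norm (x + y) ^+ 2 + real_norm (x - y) ^+ 2
  = 2 * (real_norm x ^+ 2 + real_norm y ^+ 2).
Proof.
apply: complexI; rewrite rmorphM !rmorphD/= -!inner_real_norm.
rewrite dnormD dnormB rmorph1; ring.
Qed.

Lemma inner_conj x y : '[x, y] = ('[y, x])^*%R.
Proof. by rewrite hermC expr0 mul1r. Qed.

Lemma inner_eq0C x y : '[x, y] = 0 -> '[y, x] = 0.
Proof. by move=> xy0; rewrite inner_conj xy0 rmorph0. Qed.

Lemma inner_ext x y : (forall z, '[x, z] = '[y, z]) -> x = y.
Proof.
move=> xy; apply/eqP; rewrite -subr_eq0 -(dnorm_eq0 inner) linearBl/=.
by rewrite xy subrr.
Qed.

Definition linear_subspace M :=
  M 0 /\ forall a u v, M u -> M v -> M (a *: u + v).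

Lemma linear_subspaceB M u v :
  linear_subspace M -> M u -> M v -> M (u - v).
Proof. by move=> [_ Ml] Mu Mv; rewrite addrC -scaleN1r; exact: Ml. Qed.

Lemma linear_subspaceZ M a u : linear_subspace M -> M u -> M (a *: u).
Proof. by move=> [M0 Ml] Mu; rewrite -[_ *: _]addr0; exact: Ml. Qed.

Lemma linear_subspaceD M u v :
  linear_subspace M -> M u -> M v -> M (u + v).
Proof. by move=> [M0 Ml] Mu Mv; rewrite -[u]scale1r; exact: Ml. Qed.

(** Replacing [y] by [y + t *: m] with [t = '[x - y, m] / '[m, m]] lowers the squared distance to
    [x] by [|'[x - y, m]|^2 / '[m, m]]; minimality forces this decrease to vanish. *)
Lemma nearest_point_orthogonal M x y :
  linear_subspace M -> M y ->
  (forall m, M m -> real_norm (x - y) <= real_norm (x - m)) ->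
  forall m, M m -> '[x - y, m] = 0.
Proof.
move=> Msub My ymin m Mm; have [->|m0] := eqVneq m 0; first by rewrite linear0r.
set c := '[x - y, m]; have m_gt0 : 0 < '[m, m] by rewrite dnorm_gt0.
pose t := c / '[m, m].
have : '[x - y, x - y] <= '[x - y - t *: m, x - y - t *: m].
  rewrite !inner_real_norm lecR lerXn2r ?nnegrE ?real_norm_ge0//.
  rewrite -addrA -opprD; apply: ymin; apply: linear_subspaceD => //.
  exact: linear_subspaceZ.
(* ['[m, m]] is real, so conjugating [t] affects only its numerator [c]. *)
have mE : ('[m, m])^*%R = '[m, m] by rewrite -inner_conj.
rewrite [leRHS]dnormB dnormZ linearZr_LR/= -/c normCK /t !rmorphM fmorphV/= mE.
rewrite fmorphV/= mE !conjCK -addrA lerDl.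
have -> : c / '[m, m] * (c^*%R / '[m, m]) * '[m, m]
    - (c^*%R / '[m, m] * c + c / '[m, m] * c^*%R)
  = - (`|c| ^+ 2 / '[m, m]).
  by rewrite normCK; field; rewrite lt0r_neq0.
rewrite oppr_ge0 pmulr_lle0 ?invr_gt0// => c_le0.
have : `|c| ^+ 2 == 0 by rewrite eq_le c_le0 exprn_ge0.
by rewrite sqrf_eq0 normr_eq0 => /eqP.
Qed.

(** A minimizing sequence is Cauchy by the parallelogram law; completeness provides a limit,
    closedness keeps it in [M], and the triangle inequality shows that it attains the infimum. *)
Lemma nearest_point_exists M x :
  linear_subspace M -> closed M ->
  exists2 y, M y & forall m, M m -> real_norm (x - y) <= real_norm (x - m).
Proof.
move=> Msub Mcl; pose D := [set real_norm (x - m) | m in M].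
have Dlb : has_lbound D by exists 0 => _ [m _ <-]; exact: real_norm_ge0.
have D0 : D !=set0 by exists (real_norm (x - 0)), 0 => //; exact: Msub.1.
pose d := inf D; have d_le m : M m -> d <= real_norm (x - m).
  by move=> Mm; apply: ge_inf => //; exists m.
have d_ge0 : 0 <= d.
  by apply: lb_le_inf => // _ [m _ <-]; exact: real_norm_ge0.
have /choice[u_ u_P] n : exists u, M u /\ real_norm (x - u) < d + n.+1%:R^-1.
  have n_gt0 : 0 < n.+1%:R^-1 :> R by rewrite invr_gt0.
  by have [_ [u Mu <-] ud] := inf_adherent n_gt0 (conj D0 Dlb); exists u.
(* The midpoint of [u] and [v] lies in [M], so its distance to [x] is at least [d]. The
   parallelogram law for [x - u] and [x - v] then bounds the square by [4 * (d + e)^2 - 4 * d^2],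
   which is the stated product. *)
have u_dist (e : R) u v : 0 <= e -> M u -> M v ->
    real_norm (x - u) <= d + e -> real_norm (x - v) <= d + e ->
    real_norm (u - v) ^+ 2 <= 4 * e * (2 * d + e).
  move=> e0 Mu Mv ue ve.
  have := parallelogram (x - u) (x - v).
  have -> : x - u - (x - v) = v - u by rewrite opprB addrC addrA subrK.
  have -> : real_norm (v - u) = real_norm (u - v).
    by rewrite /real_norm distrC.
  have -> : x - u + (x - v) = 2 *: (x - 2^-1 *: (u + v)).
    rewrite scalerBr scalerA divff ?pnatr_eq0// scale1r.
    by rewrite scaler_nat mulr2n addrACA opprD.
  have -> : real_norm (2 *: (x - 2^-1 *: (u + v)))
      = 2 * real_norm (x - 2^-1 *: (u + v)).
    apply: complexI; rewrite -real_normE normrZ normr_nat.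
    by rewrite rmorphM/= -real_normE rmorph_nat.
  have : d <= real_norm (x - 2^-1 *: (u + v)).
    by apply: d_le; apply: linear_subspaceZ => //; exact: linear_subspaceD.
  move: (real_norm_ge0 (x - u)) (real_norm_ge0 (x - v)) ue ve.
  set a := real_norm (x - u); set b := real_norm (x - v).
  set c := real_norm (_ - _ *: _); set w := real_norm (u - v).
  move=> a0 b0 ae be dc abcw.
  have : a ^+ 2 <= (d + e) ^+ 2 by rewrite lerXn2r ?nnegrE//; lra.
  have : b ^+ 2 <= (d + e) ^+ 2 by rewrite lerXn2r ?nnegrE//; lra.
  have : d ^+ 2 <= c ^+ 2 by rewrite lerXn2r ?nnegrE//; lra.
  by nra.
have u_cauchy : cauchy (u_ n @[n --> \oo]).
  apply: cauchy_exP => eps eps_gt0.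
  have eps_real : eps = (complex.Re eps)%:C.
    by rewrite RRe_real// realE ltW.
  move: eps_gt0; rewrite eps_real; set e := complex.Re eps; rewrite ltcR => e_gt0.
  (* This is the bound of [u_dist] at [N.+1%:R^-1], with the last summand enlarged to 1; it serves
     for [u_ N] and every later term. *)
  have [N HN] : exists N, 4 * N.+1%:R^-1 * (2 * d + 1) < e ^+ 2.
    have e4 : 0 < e ^+ 2 / (4 * (2 * d + 1)) by rewrite divr_gt0 ?exprn_gt0//; lra.
    have [N] := ltr_add_invr e4; rewrite add0r ltr_pdivlMr; last by lra.
    by move=> HN; exists N; rewrite [4 * _]mulrC -mulrA.
  exists (u_ N); exists N => // n /= Nn.
  rewrite /= -ball_normE/= real_normE ltcR.
  rewrite -(ltr_pXn2r (n := 2)) ?nnegrE ?real_norm_ge0 ?(ltW e_gt0)//.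
  have le_inv k : (N <= k)%N -> k.+1%:R^-1 <= N.+1%:R^-1 :> R.
    by move=> Nk; rewrite lef_pV2 ?posrE ?ltr0n// ler_nat.
  have invN_le1 : N.+1%:R^-1 <= 1 :> R by rewrite invf_le1 ?ltr0n// ler1n.
  have invN_ge0 : 0 <= N.+1%:R^-1 :> R by rewrite invr_ge0.
  apply: le_lt_trans HN; apply: le_trans.
    apply: (u_dist N.+1%:R^-1) => //; [exact: (u_P N).1|exact: (u_P n).1| |].
      exact/ltW/(u_P N).2.
    by apply: (le_trans (ltW (u_P n).2)); rewrite lerD2l le_inv.
  by apply: ler_wpM2l; [rewrite mulr_ge0|rewrite lerD2l].
have /cauchy_cvg/cvg_ex[y uy] := u_cauchy.
have My : M y by apply: closed_cvg Mcl _ _ uy; near=> n; exact: (u_P n).1.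
exists y => // m /d_le; apply: le_trans.
apply/ler_addgt0Pr => e e_gt0.
have e2_gt0 : 0 < e / 2 by rewrite divr_gt0.
near \oo => n.
have -> : x - y = x - u_ n + (u_ n - y) by rewrite addrA subrK.
apply: (le_trans (ler_real_normD _ _)); rewrite [e]splitr addrA lerD//.
  apply: (le_trans (ltW (u_P n).2)); rewrite lerD2l ltW//.
  by near: n; exact: near_infty_natSinv_lt (PosNum e2_gt0).
rewrite -lecR -real_normE -normrN opprB; near: n.
by apply: cvgr_dist_le uy _ _; rewrite ltcR.
Unshelve. all: by end_near. Qed.

Lemma orth_projP M x : linear_subspace M -> closed M ->
  M (orth_proj M x) /\ forall m, M m -> '[x - orth_proj M x, m] = 0.
Proof.
move=> Msub Mcl.
apply: (@xgetPex _ 0 [set y | M y /\ forall m, M m -> '[x - y, m] = 0]).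
have [y My ymin] := nearest_point_exists M x Msub Mcl.
by exists y; split => //; exact: nearest_point_orthogonal.
Qed.

(** The difference of two candidates lies in [M] and is orthogonal to [M], hence to itself. *)
Lemma orth_proj_eq M x y : linear_subspace M -> closed M ->
  M y -> (forall m, M m -> '[x - y, m] = 0) -> orth_proj M x = y.
Proof.
move=> Msub Mcl My xy; have [Mp xp] := orth_projP M x Msub Mcl.
have Mpy : M (orth_proj M x - y) by exact: linear_subspaceB.
apply/eqP; rewrite -subr_eq0 -(dnorm_eq0 inner).
have {1}-> : orth_proj M x - y = x - y - (x - orth_proj M x).
  by rewrite opprB [RHS]addrC addrA subrK.
by rewrite linearBl/= xy// xp// subrr.
Qed.

Lemma orth_proj_id M x : linear_subspace M -> closed M ->
  M x -> orth_proj M x = x.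
Proof.
by move=> Ms Mc Mx; apply: orth_proj_eq => // m _; rewrite subrr linear0l.
Qed.

Lemma range_orth_proj M : linear_subspace M -> closed M ->
  range (orth_proj M) = M.
Proof.
move=> Ms Mc; apply/seteqP; split => [_ [x _ <-]|x Mx].
  by have [] := orth_projP M x Ms Mc.
by exists x => //; exact: orth_proj_id.
Qed.

(** Both sides equal the inner product of the two projections, since each residue is orthogonal to
    [M]. *)
Lemma orth_proj_hermitian M : linear_subspace M -> closed M ->
  hermitian_operator (orth_proj M).
Proof.
move=> Ms Mc x y; have [Mp xp] := orth_projP M x Ms Mc.
have [Mq yq] := orth_projP M y Ms Mc.
transitivity '[orth_proj M x, orth_proj M y].
  rewrite -{1}(subrK (orth_proj M y) y) linearDr/= inner_eq0C ?add0r//.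
  exact: yq.
by rewrite -{2}(subrK (orth_proj M x) x) linearDl/= xp// add0r.
Qed.

Lemma orth_proj_eq0P M x : linear_subspace M -> closed M ->
  orth_proj M x = 0 <-> forall m, M m -> '[x, m] = 0.
Proof.
move=> Ms Mc; split => [x0 m Mm|xM].
  by have [_ /(_ _ Mm)] := orth_projP M x Ms Mc; rewrite x0 subr0.
by apply: orth_proj_eq => //; [exact: Ms.1|move=> m; rewrite subr0; exact: xM].
Qed.

Lemma orth_proj_linear M : linear_subspace M -> closed M ->
  linear (orth_proj M).
Proof.
move=> Ms Mc a x y; have [Mp xp] := orth_projP M x Ms Mc.
have [Mq yq] := orth_projP M y Ms Mc.
apply: orth_proj_eq => //; first exact: Ms.2.
move=> m Mm.
have -> : a *: x + y - (a *: orth_proj M x + orth_proj M y)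
    = a *: (x - orth_proj M x) + (y - orth_proj M y).
  by rewrite scalerBr opprD addrACA.
by rewrite linearDl/= linearZl_LR/= xp// yq// mulr0 addr0.
Qed.

(** Pythagoras, applied to [x] as the sum of its residue and its projection. *)
Lemma orth_proj_contraction M x : linear_subspace M -> closed M ->
  `|orth_proj M x| <= `|x|.
Proof.
move=> Ms Mc; have [Mp xp] := orth_projP M x Ms Mc.
rewrite -(ler_pXn2r (n := 2)) ?nnegrE//.
rewrite !sqr_norm_inner -[x in leRHS](subrK (orth_proj M x) x).
by rewrite [leRHS]hnormDd; [rewrite lerDr dnorm_ge0|exact: xp].
Qed.

Lemma linear_contraction_continuous A :
  linear A -> (forall x, `|A x| <= `|x|) -> continuous A.
Proof.
move=> Alin Ale x; apply/cvgrPdist_lt => e e_gt0; near=> y.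
rewrite -(zmod_morphism_linear Alin); apply: (le_lt_trans (Ale _)).
by near: y; exact: cvgr_dist_lt.
Unshelve. all: by end_near. Qed.

Lemma orth_proj_bounded M : linear_subspace M -> closed M ->
  bounded_operator (orth_proj M).
Proof.
move=> Ms Mc; split; first exact: orth_proj_linear.
apply: linear_contraction_continuous; first exact: orth_proj_linear.
by move=> x; exact: orth_proj_contraction.
Qed.

End OrthogonalProjection.

(** * Bounded operators, their kernels and their spectra *)

Section Operators.
Context {R : realType} {H : hilbertType R}.
Implicit Types (A B U V X : H -> H).

Lemma bounded_operator_comp A B :
  bounded_operator A -> bounded_operator B -> bounded_operator (A \o B).
Proof.
move=> [Al Ac] [Bl Bc]; split; first by move=> a x y /=; rewrite Bl Al.
by move=> x; apply: continuous_comp; [exact: Bc|exact: Ac].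
Qed.

Lemma bounded_operatorB A B :
  bounded_operator A -> bounded_operator B -> bounded_operator (A \- B).
Proof.
move=> [Al Ac] [Bl Bc]; split => [a x y /=|x].
  by rewrite Bl Al scalerBr opprD addrACA.
by apply: cvgB; [exact: Ac|exact: Bc].
Qed.

Lemma bounded_operatorZ (c : R[i]) A :
  bounded_operator A -> bounded_operator (c \*: A).
Proof.
move=> [Al Ac]; split => [a x y /=|x].
  by rewrite Al scalerDr !scalerA mulrC.
by apply: cvgZl_tmp; exact: Ac.
Qed.

Lemma bounded_operator_id : bounded_operator (@id H).
Proof. by split => // x. Qed.

Lemma linear_sub A x y : linear A -> A (x - y) = A x - A y.
Proof. by move=> /zmod_morphism_linear ->. Qed.

Lemma linear_add A x y : linear A -> A (x + y) = A x + A y.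
Proof. by move=> Al; rewrite -[x]scale1r Al !scale1r. Qed.

Lemma linear_scale A (a : R[i]) x : linear A -> A (a *: x) = a *: A x.
Proof. by move=> /scalable_linear ->. Qed.

Lemma linear0_val A : linear A -> A 0 = 0.
Proof. by move=> Al; have := linear_scale A 0 0 Al; rewrite !scale0r. Qed.

Lemma range_linear_subspace A : linear A -> linear_subspace (range A).
Proof.
move=> Al; split; first by exists 0 => //; exact: linear0_val.
by move=> a _ _ [x _ <-] [y _ <-]; exists (a *: x + y) => //; rewrite Al.
Qed.

Lemma kernel_linear_subspace A : linear A -> linear_subspace (Defs.kernel A).
Proof.
move=> Al; split; first exact: linear0_val.
by move=> a x y /= Ax Ay; rewrite /Defs.kernel/= Al Ax Ay scaler0 addr0.
Qed.

Lemma kernel_closed A : continuous A -> closed (Defs.kernel A).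
Proof.
move=> Ac; have -> : Defs.kernel A = A @^-1` [set 0] by [].
apply: preimage_closed; first by move=> x _; exact: Ac.
exact/accessible_closed_set1/hausdorff_accessible/norm_hausdorff.
Qed.

(** Moving [A] across the inner product turns orthogonality to the range into the vanishing of
    [A x]. Combined with [orth_proj_eq0P], it gives a Hermitian operator and its range projection
    the same kernel. *)
Lemma hermitian_kernel A x : hermitian_operator A ->
  Defs.kernel A x <-> forall y, range A y -> '[x, y] = 0.
Proof.
move=> Ah; split => [Ax _ [y _ <-]|xA].
  by rewrite -Ah Ax linear0l.
by apply: inner_ext => y; rewrite Ah linear0l xA//; exists y.
Qed.

(* If [C] inverts [B \o A - z], then [(A \o C \o B - id) / z] inverts
   [A \o B - z]. *)
Lemma spectrum_comp_subset A B : bounded_operator A -> bounded_operator B ->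
  spectrum (A \o B) `\ 0 `<=` spectrum (B \o A).
Proof.
move=> Ab Bb z [zAB /= /eqP z0] zBA; apply: zAB; case: zBA => _ [C Cb [BAC CBA]].
have zid : bounded_operator (fun x : H => z *: x).
  exact: bounded_operatorZ bounded_operator_id.
have [Al Bl] := (Ab.1, Bb.1).
have BAC' x : B (A (C x)) = x + z *: C x.
  by have /= /eqP := congr1 (@^~ x) BAC; rewrite subr_eq => /eqP.
have CBA' x : C (B (A x) - z *: x) = x by have := congr1 (@^~ x) CBA.
split; first by apply: bounded_operatorB => //; apply: bounded_operator_comp.
exists (z^-1 \*: ((A \o C \o B) \- id)).
  apply/bounded_operatorZ/bounded_operatorB; last exact: bounded_operator_id.
  by apply: bounded_operator_comp => //; exact: bounded_operator_comp.
split; apply/funext => x /=.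
- rewrite (linear_scale B)// (linear_scale A)// scalerA divff// scale1r.
  rewrite (linear_sub B)// (linear_sub A)// BAC' (linear_add A)//.
  rewrite (linear_scale A)// [A (B x) + _]addrC addrK.
  by rewrite scalerA mulVf// scale1r subKr.
- rewrite (linear_sub B)// (linear_scale B)// CBA' subKr.
  by rewrite scalerA mulVf// scale1r.
Qed.

(** Needed because the spectra of [A \o B] and [B \o A] are compared only away from 0. Moduli are
    nonnegative, so the value 0 cannot affect a supremum over a nonempty bounded set; the other
    cases rest on the default value of [sup]. *)
Lemma spectral_radius_setD0 A :
  spectral_radius A = sup [set complex.Re `|z| | z in spectrum A `\ 0].
Proof.
rewrite /spectral_radius; set S := spectrum A; set E := [set _ | _ in S `\ 0].
have ES : E `<=` [set complex.Re `|z| | z in S].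
  by move=> _ [z [Sz _] <-]; exists z.
have SE r : [set complex.Re `|z| | z in S] r -> r = 0 \/ E r.
  move=> [z Sz <-]; have [->|z0] := eqVneq z 0; first by left; rewrite normr0.
  by right; exists z => //; split => //; exact/eqP.
(* If [E] is empty, the moduli form the empty set or the singleton of 0, and [sup] is 0 either
   way. *)
have [[e Ee]|E0] := pselect (E !=set0); last first.
  rewrite [in RHS](_ : E = set0) ?sup0; last first.
    by apply/seteqP; split => // r Er; apply: E0; exists r.
  have [s|S0] := pselect ([set complex.Re `|z| | z in S] !=set0); last first.
    by rewrite sup_out// => -[].
  rewrite (_ : [set _ | _ in S] = [set 0]) ?sup1//; apply/seteqP.
  have S0 r : [set complex.Re `|z| | z in S] r -> r = 0.
    by move=> /SE[//|Er]; case: E0; exists r.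
  split => [r /S0//|_ ->]; by case: s => r Sr; rewrite -(S0 r).
(* If [E] is unbounded, so is the larger set, and both suprema take the same default value. *)
have [Eub|Enub] := pselect (has_ubound E); last first.
  rewrite !sup_out//; first by move=> [].
  by move=> [_ [b Sb]]; apply: Enub; exists b => r /ES/Sb.
have E_ge0 r : E r -> 0 <= r.
  by move=> [z _ <-]; rewrite -ler0c RRe_real ?normr_real.
rewrite -(@sup_setU _ ([set complex.Re `|z| | z in S] `&` [set 0]) E) //.
- congr sup; apply/seteqP; split => r; last by move=> [[]//|/ES].
  by move=> Sr; have [r0|] := SE _ Sr; [left|right].
- by split => //; exists e.
- by move=> a b [_ ->] /E_ge0.
Qed.

Lemma spectral_radius_comp A B : bounded_operator A -> bounded_operator B ->
  spectral_radius (A \o B) = spectral_radius (B \o A).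
Proof.
move=> Ab Bb; rewrite !spectral_radius_setD0; congr sup; congr image.
have sub (C D : H -> H) : bounded_operator C -> bounded_operator D ->
    spectrum (C \o D) `\ 0 `<=` spectrum (D \o C) `\ 0.
  move=> Cb Db z zCD; split; last by case: zCD.
  exact: (spectrum_comp_subset _ _ Cb Db z zCD).
by apply/seteqP; split; exact: sub.
Qed.

(** * The Moore-Penrose inverse of a projection composed with an invertible operator *)

Section ProjectionComp.
Variables (M : set H) (G : H -> H).
Hypotheses (Msub : linear_subspace M) (Mcl : closed M).
Hypothesis Ginv : invertible_operator G.
Let P := orth_proj M.
Let Pb : bounded_operator P := orth_proj_bounded M Msub Mcl.
Let U := P \o G.

Let PP x : P (P x) = P x.
Proof. by apply: orth_proj_id => //; have [] := orth_projP M x Msub Mcl. Qed.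

Let Ub : bounded_operator U.
Proof. exact: bounded_operator_comp Pb Ginv.1. Qed.

(* With [Q] the projection onto the orthogonal complement of [kernel U], the
   pseudo-inverse of [U = P \o G] is [Q \o G^-1 \o P]: indeed [U \o Q = U], and
   [G^-1 (P (G x)) - x] lies in [kernel U]. *)
Lemma is_moore_penrose_orth_proj_comp : exists X, is_moore_penrose U X.
Proof.
have [Gb [K Kb [GK' KG']]] := Ginv.
have GK x : G (K x) = x by have := congr1 (@^~ x) GK'.
have KG x : K (G x) = x by have := congr1 (@^~ x) KG'.
have Nsub := kernel_linear_subspace U Ub.1.
have Ncl := kernel_closed U Ub.2.
pose N := orth_proj (Defs.kernel U); pose Q (y : H) := y - N y.
have Nb : bounded_operator N := orth_proj_bounded _ Nsub Ncl.
have Qb : bounded_operator Q.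
  by apply: bounded_operatorB => //; exact: bounded_operator_id.
have UQ x : U (Q x) = U x.
  rewrite /Q (linear_sub U _ _ Ub.1).
  have [UN _] := orth_projP _ x Nsub Ncl.
  by rewrite /N [U (orth_proj _ _)]UN subr0.
(* Points with the same image under [U] differ by an element of its kernel, which [Q]
   annihilates. *)
have QN x y : U x = U y -> Q x = Q y.
  move=> xy; have Nxy : N (x - y) = x - y.
    apply: orth_proj_id => //.
    by rewrite /Defs.kernel/= (linear_sub U _ _ Ub.1) xy subrr.
  apply/eqP; rewrite /Q subr_eq -addrA [- N y + _]addrC.
  by rewrite -(linear_sub N _ _ Nb.1) Nxy addrC subrK.
(* For [X = Q \o K \o P] this and the next line give [U \o X = P] and [X \o U = Q], so the last two
   Penrose equations reduce to the self-adjointness of orthogonal projections. *)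
have UX x : U (Q (K (P x))) = P x by rewrite UQ /U/= GK PP.
have XU x : Q (K (P (U x))) = Q x by apply: QN; rewrite /U/= GK !PP.
exists (Q \o K \o P); split.
- by apply: bounded_operator_comp => //; exact: bounded_operator_comp.
- by apply/funext => x /=; rewrite UX /U/= PP.
- by apply/funext => x /=; rewrite XU; apply: QN; rewrite UQ.
- move=> x y /=; rewrite !UX.
  exact: orth_proj_hermitian.
- move=> x y; rewrite /comp !XU /Q linearBl/= linearBr/=.
  by rewrite (orth_proj_hermitian _ Nsub Ncl).
Qed.

(** [U \o X] is self-adjoint with values in [M], and it fixes each [P y] because [P y] is the image
    under [U] of the preimage of [y] by [G]. Moving first [P] and then [U \o X] across the inner
    product identifies it with [P]. *)
Lemma orth_proj_comp_moore_penrose x : U (moore_penrose U x) = P x.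
Proof.
have [_ UXU _ UXh _] : is_moore_penrose U (moore_penrose U).
  exact: (@xgetPex _ (fun=> 0) [set X | is_moore_penrose U X]
    is_moore_penrose_orth_proj_comp).
set X := moore_penrose U in UXU UXh *.
have [_ [K _ [GK' _]]] := Ginv.
have UXP y : U (X (P y)) = P y.
  have UK : U (K y) = P y by rewrite -[in RHS](congr1 (@^~ y) GK').
  by have /= := congr1 (@^~ (K y)) UXU; rewrite UK.
apply: inner_ext => y; rewrite -[U (X x)]PP.
rewrite (orth_proj_hermitian _ Msub Mcl).
by rewrite [LHS]UXh/= UXP (orth_proj_hermitian _ Msub Mcl).
Qed.

Lemma spectral_radius_moore_penrose_comp V :
  bounded_operator V -> V \o P = V ->
  spectral_radius (moore_penrose U \o (V \o G)) = spectral_radius V.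
Proof.
move=> Vb VP; have [Xb _ _ _ _] : is_moore_penrose U (moore_penrose U).
  exact: (@xgetPex _ (fun=> 0) [set X | is_moore_penrose U X]
    is_moore_penrose_orth_proj_comp).
rewrite spectral_radius_comp//; last exact: bounded_operator_comp Vb Ginv.1.
(* Expanding [V] as [V \o P] places [P] in front of [G], which makes [U] composed with its
   pseudo-inverse appear. *)
congr spectral_radius; apply/funext => x; rewrite -{1}VP/=.
by rewrite [P _]orth_proj_comp_moore_penrose; have := congr1 (@^~ x) VP.
Qed.

End ProjectionComp.

End Operators.

(** * Splittings induced by the range projection and comparison of their convergence *)

Theorem proposition7p1 (R : realType) (H : hilbertType R) (S T G : H -> H)
    (S_bounded : bounded_operator S)
    (T_bounded : bounded_operator T)
    (T_hermitian : hermitian_operator T)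
    (T_closed_range : closed_range T)
    (G_invertible : invertible_operator G)
    (S_eq : S = T \o G) :
  let P := range_proj T in
  let V := P \- T in
  proper_splitting S (P \o G) (V \o G) /\
  (splitting_converges P V <-> splitting_converges (P \o G) (V \o G)).
Proof.
move=> P V; have Gb := G_invertible.1.
have Msub := range_linear_subspace T T_bounded.1.
have Pb : bounded_operator P := orth_proj_bounded _ Msub T_closed_range.
have Vb : bounded_operator V by exact: bounded_operatorB.
have range_comp (A : H -> H) : range (A \o G) = range A.
  have [_ [K _ [GK _]]] := G_invertible.
  apply/seteqP; split => _ [x _ <-]; first by exists (G x).
  by exists (K x) => //=; have /= -> := congr1 (@^~ x) GK.
(* Both kernels are the orthogonal complement of the range of [T]. *)
have kerP x : P x = 0 <-> T x = 0.
  exact: iff_trans (orth_proj_eq0P _ x Msub T_closed_range)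
    (iff_sym (hermitian_kernel T x T_hermitian)).
(* [P x - x] is annihilated by [P], hence by [T] through [kerP], so [T (P x) = T x]. *)
have VP : V \o P = V.
  apply/funext => x; have PPx : P (P x) = P x.
    apply: orth_proj_id => //.
    by have [] := orth_projP _ x Msub T_closed_range.
  rewrite /V/= PPx; congr (_ - _); apply/eqP; rewrite -subr_eq0.
  rewrite -(linear_sub T _ _ T_bounded.1); apply/eqP/kerP.
  by rewrite (linear_sub P _ _ Pb.1) PPx subrr.
split; last first.
  (* The identity takes the place of [G], so that one lemma evaluates both spectral radii as that of
     [V]. *)
  have id_inv : invertible_operator (@id H).
    have idb := @bounded_operator_id R H.
    by split => //; exists id.
  rewrite /splitting_converges.
  rewrite (spectral_radius_moore_penrose_comp _ _ Msub T_closed_range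
    G_invertible)//.
  have := spectral_radius_moore_penrose_comp _ _ Msub T_closed_range
    id_inv _ Vb VP.
  by rewrite -/P => <-.
split.
- by split => //; rewrite /closed_range S_eq range_comp.
- by split; exact: bounded_operator_comp.
- by rewrite S_eq; apply/funext => x /=; rewrite /V/= subKr.
- by rewrite S_eq !range_comp [LHS]range_orth_proj.
- by rewrite S_eq; apply/seteqP; split => x /kerP.
Qed.
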